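(* Assume the Diagonal Conjecture (DC) holds: for every $r \ge 2$, all integers $3 \le s \le t$ and all integers $k_3,\dots,k_r \ge 2$, we have $R(s,t,k_3,\dots,k_r) \ge R(s-1,t+1,k_3,\dots,k_r)$. Then for every integer $k \ge 3$, $$\lim_{r\to\infty} \frac{R_r(k)^{1/r}}{R_r(k-1)^{1/r}} > 1.$$
   Context: $R(k_1,\dots,k_r)$ denotes the multicolor Ramsey number: the least $n$ such that every coloring of the edges of $K_n$ with $r$ colors contains, for some $i$, a complete subgraph $K_{k_i}$ all of whose edges have color $i$; it is symmetric in its arguments. $R_r(k)=R(k,\dots,k)$ with $r$ arguments equal to $k$; note $R_r(2)=2$. *)

(* Defs.v *)
From Stdlib Require Import Reals ClassicalEpsilon.
From Coquelicot Require Import Coquelicot.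
From mathcomp Require Import all_boot.

Set Implicit Arguments.
Unset Strict Implicit.
Unset Printing Implicit Defensive.

(* Edge colourings of K_n (vertex set 'I_n) with r = size ks colours are given
   by c : {ffun 'I_n * 'I_n -> 'I_r}; only the values c (x,y) with x < y
   (one per edge {x,y}) are relevant.  [ramsey_prop ks n] says that every such
   colouring has, for some colour i, a set S of ks_i vertices all of whose
   edges have colour i. *)
Definition ramsey_prop (ks : seq nat) (n : nat) : bool :=
  [forall c : {ffun 'I_n * 'I_n -> 'I_(size ks)},
     [exists i : 'I_(size ks), exists S : {set 'I_n},
        (#|S| == nth 0%N ks i) &&
        [forall x in S, forall y in S, (x < y)%N ==> (c (x, y) == i)]]].

(* The multicolour Ramsey number R(k_1,...,k_r): the least n with
   ramsey_prop ks n (set to 0 if no such n exists, which by Ramsey's theorem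
   never happens). *)
Definition Ramsey (ks : seq nat) : nat :=
  match excluded_middle_informative (exists n, ramsey_prop ks n) with
  | left h => ex_minn h
  | right _ => 0
  end.

Definition Ramsey_diag (r k : nat) : nat := Ramsey (nseq r k).

Definition DiagonalConjecture : Prop :=
  forall (s t : nat) (ks : seq nat),
    (3 <= s)%N -> (s <= t)%N -> all (fun k => 2 <= k)%N ks ->
    (Ramsey (s.-1 :: t.+1 :: ks) <= Ramsey (s :: t :: ks))%N.

Definition ramsey_ratio (k r : nat) : R :=
  Rdiv (Rpower (INR (Ramsey_diag r k)) (Rinv (INR r)))
       (Rpower (INR (Ramsey_diag r k.-1)) (Rinv (INR r))).

(* Main.v *)
(** Write N(ks) = R(ks) - 1.  Lexicographic products of colourings give
    N(p_1 q_1 + 1, ..., p_r q_r + 1) >= N(p_1 + 1, ...) N(q_1 + 1, ...).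
    With suitable colours of size 2 this makes N_r(k) supermultiplicative in
    r, so that N_r(k)^(1/r) converges (Fekete).  DC allows k - 2 colours
    (k, ..., k) to be replaced by (k-1, ..., k-1, 2k-3), and
    2k-3 = 2(k-2) + 1, hence
      N_r(k) >= N_r(k-1) N_m(3),   m = floor(r / (k-2)).
    If N_r(3)^(1/r) is unbounded, then the ratio tends to infinity.  Otherwise
    DC, replacing (3, ..., 3) by (2, ..., 2, k), gives N_r(k) <= N_{r(k-2)}(3),
    all limits are finite, and N_m(3) >= 2^m bounds the limit of the ratio
    away from 1. *)

Require Import Defs.
From Stdlib Require Import Reals ClassicalEpsilon Lra.
From Coquelicot Require Import Coquelicot.
From mathcomp Require Import all_boot zify.

Set Implicit Arguments.
Unset Strict Implicit.
Unset Printing Implicit Defensive.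

Local Open Scope nat_scope.

(** * Symmetric colourings, Ramsey's theorem, and constructions on colourings *)

Definition mono (V : finType) (c : V -> V -> nat) (S : {set V}) (i : nat) : Prop :=
  {in S &, forall x y, x != y -> c x y = i}.

(* The bound [c x y < r] also on the diagonal makes [avoids 0 k V] fail for
   nonempty [V], in agreement with [ramsey_prop [::]]. *)
Definition avoids (r : nat) (k : nat -> nat) (V : finType) : Prop :=
  exists c : V -> V -> nat,
    [/\ forall x y, c x y = c y x,
        forall x y, c x y < r
      & forall i S, i < r -> mono c S i -> #|S| < k i].

Lemma monoS (V : finType) (c : V -> V -> nat) (S T : {set V}) i :
  S \subset T -> mono c T i -> mono c S i.
Proof. by move=> /subsetP sST mT x y /sST xT /sST yT; apply: mT. Qed.

Lemma avoids_inj (V W : finType) (f : V -> W) r k :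
  injective f -> avoids r k W -> avoids r k V.
Proof.
move=> f_inj [c [c_sym c_lt c_av]]; exists (fun x y => c (f x) (f y)); split=> //.
move=> i S i_lt mS; rewrite -(card_imset _ f_inj); apply: c_av => //.
by move=> _ _ /imsetP[x xS ->] /imsetP[y yS ->]; rewrite inj_eq //; apply: mS.
Qed.

Lemma avoids_card (V W : finType) r k :
  #|V| <= #|W| -> avoids r k W -> avoids r k V.
Proof.
move=> leVW; apply: (@avoids_inj _ _ (fun x => enum_val (widen_ord leVW (enum_rank x)))).
by move=> x y /enum_val_inj/(congr1 val) /= /ord_inj/enum_rank_inj.
Qed.

Lemma subset_of_card (V : finType) (S : {set V}) n :
  n <= #|S| -> exists2 T : {set V}, T \subset S & #|T| = n.
Proof.
elim: n => [_|n IHn ltn]; first by exists set0; rewrite ?sub0set ?cards0.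
have [T sTS cT] := IHn (ltnW ltn).
have : T \proper S by rewrite properEcard sTS cT.
case/properP=> _ [x xS xT]; exists (x |: T); last by rewrite cardsU1 xT cT.
by rewrite subUset sub1set xS.
Qed.

(** A colouring read only at pairs [x < y] extends to a symmetric one along the order, and a
    monochromatic set that is too large shrinks to one of the exact size. *)
Lemma ramsey_propP ks n :
  ramsey_prop ks n <-> ~ avoids (size ks) (nth 0 ks) 'I_n.
Proof.
split=> [/forallP rp [c [c_sym c_lt c_av]]|nav].
  pose C := [ffun p : 'I_n * 'I_n => Ordinal (c_lt p.1 p.2)].
  have /existsP[i /existsP[S /andP[/eqP cS /forallP mS]]] := rp C.
  suff : #|S| < nth 0 ks i by rewrite cS ltnn.
  apply: c_av => // x y xS yS.
  wlog ltxy : x y xS yS / x < y.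
    move=> wl neq; have := neq; rewrite -val_eqE /= neq_ltn => /orP[] lt.
      exact: wl.
    by rewrite c_sym; apply: wl => //; rewrite eq_sym.
  move=> _; have /implyP/(_ xS)/forallP/(_ y)/implyP/(_ yS) := mS x.
  by rewrite ltxy ffunE => /eqP/(congr1 val).
apply/negPn/negP => /forallPn[C /existsPn nC]; apply: nav.
exists (fun x y : 'I_n => val (if x <= y then C (x, y) else C (y, x))); split.
- by move=> x y; case: ltngtP => // /ord_inj ->.
- by move=> x y; apply: ltn_ord.
move=> i S i_lt mS; rewrite ltnNge; apply/negP => /subset_of_card[T sTS cT].
have /existsPn/(_ T) := nC (Ordinal i_lt); rewrite /= cT eqxx /=.
case/negP; apply/forallP => x; apply/implyP => xT; apply/forallP => y.
apply/implyP => yT; apply/implyP => ltxy; apply/eqP/val_inj => /=.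
have /(_ (negbT (ltn_eqF ltxy))) := monoS sTS mS xT yT.
by rewrite (ltnW ltxy).
Qed.

(** Ramsey's theorem, by induction on the sum of the bounds. Working inside a subset [W] lets the
    induction pass to the neighbours of a vertex in one colour. *)
Lemma clique_exists r (k : nat -> nat) : exists n, forall (V : finType) (c : V -> V -> nat),
  (forall x y, c x y = c y x) -> (forall x y, c x y < r) -> forall W : {set V}, n < #|W| ->
  exists i, exists S : {set V}, [/\ i < r, S \subset W, mono c S i & k i <= #|S|].
Proof.
move: {2}(\sum_(i < r) k i) (leqnn (\sum_(i < r) k i)) => m.
elim: m => [|m IHm] in k *.
  (* All bounds are 0, so the empty set is a clique; the diagonal value [c x x] shows that there is
     a colour. *)
  move=> sum0; exists 0 => V c _ c_lt W /card_gt0P[x _].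
  have r_gt0 : 0 < r by apply: leq_ltn_trans (c_lt x x).
  exists 0, set0; split; rewrite ?sub0set ?cards0 //; first by move=> ? ?; rewrite inE.
  by apply: leq_trans sum0; rewrite (bigD1 (Ordinal r_gt0)) //= leq_addr.
move=> sumk.
(* A zero bound is met by the empty set; if there is none, lowering any one bound really decreases
   the sum. *)
have [/existsP[i /eqP ki0]|/existsPn k_gt0] := boolP [exists i : 'I_r, k i == 0].
  exists 0 => V c _ _ W _; exists i, set0.
  by split; rewrite ?sub0set ?cards0 ?ki0 //; move=> ? ?; rewrite inE.
pose dec (i j : nat) := if j == i then (k j).-1 else k j.
have /fin_all_exists[n nP] : forall i : 'I_r, exists n,
    forall (V : finType) (c : V -> V -> nat),
      (forall x y, c x y = c y x) -> (forall x y, c x y < r) ->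
      forall W : {set V}, n < #|W| ->
    exists j, exists S : {set V}, [/\ j < r, S \subset W, mono c S j & dec i j <= #|S|].
  move=> i; apply: IHm; rewrite -ltnS; apply: leq_trans sumk.
  rewrite (bigD1 i) //= [leqRHS](bigD1 i) //= {1}/dec eqxx -addSn prednK ?lt0n //.
  rewrite leq_add2l; apply/leq_sum => j /negPf neq.
  by rewrite /dec val_eqE neq.
(* One vertex [x] is set aside and more than [\sum n i] remain, so by pigeonhole some colour [i]
   joins [x] to more than [n i] of them. *)
exists (\sum_(i < r) n i).+1 => V c c_sym c_lt W ltW.
have /card_gt0P[x xW] : 0 < #|W| by apply: leq_ltn_trans ltW.
pose U (i : 'I_r) := [set y in W :\ x | c x y == i].
have [i ltU] : exists i : 'I_r, n i < #|U i|.
  apply/existsP; apply: contraT => /existsPn leU.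
  have : #|W :\ x| <= \sum_(i < r) n i.
    apply: (@leq_trans (\sum_(i < r) #|U i|)); last first.
      by apply: leq_sum => i _; rewrite leqNgt leU.
    rewrite -sum1_card (partition_big (fun y => Ordinal (c_lt x y)) xpredT) //=.
    apply: leq_sum => i _; rewrite -sum1_card leq_eqVlt; apply/orP; left.
    by apply/eqP/eq_bigl => y; rewrite [RHS]inE -val_eqE.
  by rewrite (cardsD1 x W) xW in ltW; lia.
have [j [S [j_lt sSU mS leS]]] := nP i V c c_sym c_lt _ ltU.
have sUW : U i \subset W by apply/subsetP=> y; rewrite !inE => /andP[/andP[]].
have [ij|nij] := eqVneq j i; last first.
  by exists j, S; move: leS; rewrite /dec (negPf nij); split=> //; apply: subset_trans sUW.
(* In the lowered colour the clique may be one vertex short; adding [x] makes up for it. *)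
subst j; have xS : x \notin S.
  by apply/negP => /(subsetP sSU); rewrite !inE eqxx.
exists i, (x |: S); split=> //.
- by rewrite subUset sub1set xW (subset_trans sSU).
- have cx y : y \in S -> c x y = i.
    by move/(subsetP sSU); rewrite !inE => /andP[_ /eqP].
  move=> y z; rewrite !inE => /orP[/eqP->|yS] /orP[/eqP->|zS]; rewrite ?eqxx //.
  + by rewrite cx.
  + by rewrite c_sym cx.
  + exact: mS.
- by move: leS; rewrite cardsU1 xS /dec eqxx; lia.
Qed.

(** Turns inequalities between Ramsey numbers into constructions of colourings. [clique_exists]
    rules out the default value 0, and restriction to fewer vertices handles all [n] below the
    minimum. *)
Lemma lt_Ramsey ks n : n < Ramsey ks <-> avoids (size ks) (nth 0 ks) 'I_n.
Proof.
rewrite /Ramsey; case: excluded_middle_informative => [ex|nex]; last first.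
  have [n0 n0P] := clique_exists (size ks) (nth 0 ks).
  case: nex; exists n0.+1; apply/ramsey_propP => -[c [c_sym c_lt c_av]].
  have [|i [S [i_lt _ mS]]] := n0P _ c c_sym c_lt [set: 'I_n0.+1].
    by rewrite cardsT card_ord.
  by rewrite leqNgt c_av.
case: ex_minnP => m /ramsey_propP nav m_min; split=> [ltnm|av].
  have : ~~ ramsey_prop ks n by apply/negP => /m_min; rewrite leqNgt ltnm.
  move/negP => nrp; apply: NNPP => nav'; apply: nrp; exact/ramsey_propP.
rewrite ltnNge; apply/negP => lemn; apply: nav.
by apply: avoids_card av; rewrite !card_ord.
Qed.

Lemma avoids_lt_Ramsey ks (V : finType) :
  avoids (size ks) (nth 0 ks) V -> #|V| < Ramsey ks.
Proof. by move=> av; apply/lt_Ramsey; apply: avoids_card av; rewrite card_ord. Qed.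

Lemma leq_Ramsey ks ls :
  (forall n, avoids (size ks) (nth 0 ks) 'I_n -> avoids (size ls) (nth 0 ls) 'I_n) ->
  Ramsey ks <= Ramsey ls.
Proof.
move=> sub; case E: (Ramsey ks) => [//|n].
by apply/lt_Ramsey/sub/lt_Ramsey; rewrite E.
Qed.

(* A colour with bound at most 2 is never used on an edge, so [s] only has to
   be injective on the other colours. *)
Lemma avoids_recolour r r' k k' (s : nat -> nat) (V : finType) :
  0 < r' -> (forall j, j < r' -> 2 <= k' j) ->
  (forall i, i < r -> 2 < k i -> s i < r' /\ k i <= k' (s i)) ->
  (forall i j, i < r -> j < r -> 2 < k i -> 2 < k j -> s i = s j -> i = j) ->
  avoids r k V -> avoids r' k' V.
Proof.
move=> r'_gt0 k'_ge2 sP s_inj [c [c_sym c_lt c_av]].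
have c_gt2 x y : x != y -> 2 < k (c x y).
  move=> neq; suff : #|[set x; y]| < k (c x y) by rewrite cards2 neq.
  apply: c_av => // u v; rewrite !inE => /orP[]/eqP-> /orP[]/eqP->; rewrite ?eqxx //.
(* [c x x] may be a colour about which nothing is known under [s], so the diagonal gets colour 0. *)
exists (fun x y => if x == y then 0 else s (c x y)); split.
- by move=> x y; rewrite eq_sym c_sym.
- move=> x y; case: eqVneq => [//|neq]; have [//] := sP (c x y) (c_lt x y) (c_gt2 _ _ neq).
move=> j S j_lt mS; have [leS|/card_gt1P[x [y [xS yS neq]]]] := leqP #|S| 1.
  by apply: leq_ltn_trans leS _; apply: k'_ge2.
have := mS _ _ xS yS neq; rewrite (negPf neq) => def_j; rewrite -def_j.
have [_] := sP _ (c_lt x y) (c_gt2 _ _ neq); apply: leq_trans.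
apply: c_av => // u v uS vS nuv; apply: s_inj; rewrite ?c_gt2 //.
by rewrite def_j; have := mS _ _ uS vS nuv; rewrite (negPf nuv).
Qed.

(** Lexicographic product: [d] inside the blocks, [c] between them. A monochromatic set meets at
    most [(k i).-1] blocks, each in at most [(l i).-1] points. *)
Lemma avoids_prod r k l (V W : finType) :
  avoids r k V -> avoids r l W ->
  avoids r (fun i => ((k i).-1 * (l i).-1).+1) (V * W)%type.
Proof.
move=> [c [c_sym c_lt c_av]] [d [d_sym d_lt d_av]].
exists (fun p q => if p.1 == q.1 then d p.2 q.2 else c p.1 q.1); split.
- by move=> x y; rewrite eq_sym c_sym d_sym.
- by move=> x y; case: ifP.
move=> i S i_lt mS; rewrite ltnS.
pose fib x := [set p in S | p.1 == x].
have leA : #|[set p.1 | p in S]| <= (k i).-1.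
  rewrite -ltnS; apply: leq_trans (leqSpred _).
  apply: c_av => // _ _ /imsetP[p pS ->] /imsetP[q qS ->] neq.
  have := mS p q pS qS; rewrite (negPf neq) => -> //.
  by apply: contra neq => /eqP->.
have lefib x : #|fib x| <= (l i).-1.
  have inj2 : {in fib x &, injective (@snd V W)}.
    by move=> [a b] [a' b']; rewrite !inE /= => /andP[_ /eqP->] /andP[_ /eqP->] ->.
  rewrite -(card_in_imset inj2) -ltnS; apply: leq_trans (leqSpred _).
  apply: d_av => // _ _ /imsetP[p + ->] /imsetP[q + ->].
  rewrite !inE => /andP[pS /eqP px] /andP[qS /eqP qx] neq.
  have := mS p q pS qS; rewrite px qx eqxx => -> //.
  by apply: contra neq => /eqP->.
rewrite -sum1_card (partition_big (@fst V W) (mem [set p.1 | p in S])) /=; last first.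
  by move=> p pS; apply: imset_f.
apply: (@leq_trans (\sum_(x in [set p.1 | p in S]) (l i).-1)).
  apply: leq_sum => x _; apply: leq_trans (lefib x); rewrite -sum1_card.
  by apply/eq_leq/eq_bigl => p; rewrite !inE.
by rewrite sum_nat_const leq_mul.
Qed.

(** * Inequalities between Ramsey numbers *)

Lemma leq_predn m n : m <= n -> m.-1 <= n.-1.
Proof. by lia. Qed.

Lemma avoids_leq r k k' (V : finType) :
  (forall i, i < r -> k i <= k' i) -> avoids r k V -> avoids r k' V.
Proof.
move=> lek [c [c_sym c_lt c_av]]; exists c; split=> // i S i_lt mS.
by apply: leq_trans (lek i i_lt); apply: c_av.
Qed.

(** Colour [i] of [ks] is renamed to its index [nth 0 Is i] in [ls]. The empty list is separate
    because recolouring needs a colour for the diagonal. *)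
Lemma leq_perm_Ramsey ks ls :
  perm_eq ks ls -> all (leq 2) ls -> Ramsey ks <= Ramsey ls.
Proof.
move=> eq_kl ls_ge2; have [ls0|ls_n0] := eqVneq ls [::].
  by move: eq_kl; rewrite ls0 => /perm_nilP->.
have ls_gt0 : 0 < size ls by rewrite lt0n size_eq0.
have [Is pIs def_ks] := perm_iotaP 0 eq_kl.
have sz : size Is = size ks by rewrite def_ks size_map.
apply: leq_Ramsey => n; apply: (@avoids_recolour _ _ _ _ (nth 0 Is)) => //.
- by move=> j; apply/all_nthP.
- move=> i i_lt _; rewrite -sz in i_lt; split.
    have : nth 0 Is i \in iota 0 (size ls) by rewrite -(perm_mem pIs) mem_nth.
    by rewrite mem_iota.
  by rewrite def_ks (nth_map 0).
move=> i j i_lt j_lt _ _ /eqP; rewrite nth_uniq ?sz //; first by move/eqP.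
by rewrite (perm_uniq pIs) iota_uniq.
Qed.

Lemma leq_Ramsey_pad a ks :
  all (leq 2) ks -> Ramsey ks <= Ramsey (nseq a 2 ++ ks).
Proof.
case: a => [//|a] ks_ge2.
apply: leq_Ramsey => n; apply: (@avoids_recolour _ _ _ _ (addn a.+1)).
- by rewrite size_cat size_nseq.
- by move=> j; apply/all_nthP; rewrite all_cat all_nseq orbT.
- move=> i i_lt _; rewrite size_cat size_nseq ltn_add2l; split=> //.
  by rewrite nth_cat size_nseq ltnNge leq_addr addKn.
- by move=> i j _ _ _ _ /addnI.
Qed.

Lemma leq_Ramsey_unpad a ks :
  0 < size ks -> all (leq 2) ks -> Ramsey (nseq a 2 ++ ks) <= Ramsey ks.
Proof.
move=> ks_gt0 ks_ge2.
have gea i : 2 < nth 0 (nseq a 2 ++ ks) i -> a <= i.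
  by rewrite nth_cat size_nseq nth_nseq; case: (ltnP i a).
apply: leq_Ramsey => n; apply: (@avoids_recolour _ _ _ _ (subn^~ a)) => //.
- by move=> j; apply/all_nthP.
- move=> i + /gea lei; rewrite size_cat size_nseq nth_cat size_nseq (ltnNge i a) lei /=.
  by split=> //; lia.
- by move=> i j _ _ /gea + /gea; lia.
Qed.

Lemma Ramsey_prod ks ls ms :
  size ks = size ms -> size ls = size ms ->
  (forall i, i < size ms -> ((nth 0 ks i).-1 * (nth 0 ls i).-1).+1 <= nth 0 ms i) ->
  (Ramsey ks).-1 * (Ramsey ls).-1 <= (Ramsey ms).-1.
Proof.
move=> szk szl lem; case Ek: (Ramsey ks) => [//|n]; case El: (Ramsey ls) => [|m].
  by rewrite muln0.
have avk : avoids (size ms) (nth 0 ks) 'I_n by rewrite -szk; apply/lt_Ramsey; rewrite Ek.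
have avl : avoids (size ms) (nth 0 ls) 'I_m by rewrite -szl; apply/lt_Ramsey; rewrite El.
have := avoids_lt_Ramsey (avoids_leq lem (avoids_prod avk avl)).
by rewrite card_prod !card_ord; case: (Ramsey ms).
Qed.

(* The largest order of a colouring with [r] colours and no monochromatic K_k. *)
Definition Ndiag k r := (Ramsey_diag r k).-1.

Lemma all_geq2_nseq a k : 2 <= k -> all (leq 2) (nseq a k).
Proof. by move=> k_ge2; rewrite all_nseq k_ge2 orbT. Qed.

(** Padding with 2s on opposite sides makes the two lists complementary: at each position one entry
    is [k] and the other 2, and (k-1)(2-1)+1 = k. *)
Lemma Ndiag_supermul k a b : 2 <= k -> Ndiag k a * Ndiag k b <= Ndiag k (a + b).
Proof.
move=> k_ge2; have all2 := all_geq2_nseq.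
have padb := leq_Ramsey_pad a (all2 b k k_ge2).
have : Ramsey (nseq a k) <= Ramsey (nseq a k ++ nseq b 2).
  apply: leq_trans (leq_Ramsey_pad b (all2 a k k_ge2)) _.
  by apply: leq_perm_Ramsey; [rewrite perm_catC | rewrite all_cat !all2].
move=> pada; apply: (@leq_trans ((Ramsey (nseq a k ++ nseq b 2)).-1 *
                                 (Ramsey (nseq a 2 ++ nseq b k)).-1)).
  by apply: leq_mul; apply: leq_predn.
apply: Ramsey_prod; rewrite ?size_cat ?size_nseq // => i i_lt.
rewrite !nth_cat !nth_nseq !size_nseq i_lt.
by case: (ltnP i a) => lei; [|have -> : i - a < b by lia]; rewrite /=; lia.
Qed.

Lemma leq_Ndiag k l r : k <= l -> Ndiag k r <= Ndiag l r.
Proof.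
move=> lekl; apply: leq_predn; apply: leq_Ramsey => n.
rewrite !size_nseq; apply: avoids_leq => i i_lt.
by rewrite !nth_nseq i_lt.
Qed.

Lemma Ndiag3_1 : 2 <= Ndiag 3 1.
Proof.
have : #|{: bool}| < Ramsey [:: 3]; last by rewrite card_bool /Ndiag /Ramsey_diag /=; lia.
apply: avoids_lt_Ramsey; exists (fun _ _ => 0); split=> // -[|//] S _ _.
by rewrite ltnS -card_bool max_card.
Qed.

Lemma Ndiag2_1 : 0 < Ndiag 2 1.
Proof.
have : #|{: unit}| < Ramsey [:: 2]; last by rewrite card_unit /Ndiag /Ramsey_diag /=; lia.
apply: avoids_lt_Ramsey; exists (fun _ _ => 0); split=> // -[|//] S _ _.
by rewrite ltnS -card_unit max_card.
Qed.

Lemma Ndiag_gt0 k r : 2 <= k -> 0 < r -> 0 < Ndiag k r.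
Proof.
move=> k_ge2; elim: r => [//|[_ _|r IHr _]].
  exact: leq_trans Ndiag2_1 (leq_Ndiag 1 k_ge2).
rewrite -(addn1 r.+1); apply: leq_trans (Ndiag_supermul _ _ k_ge2).
by rewrite muln_gt0 IHr // (leq_trans Ndiag2_1 (leq_Ndiag 1 k_ge2)).
Qed.

Lemma Ndiag3_geq r : 0 < r -> 2 ^ r <= Ndiag 3 r.
Proof.
elim: r => [//|[_ _|r IHr _]]; first exact: Ndiag3_1.
rewrite -(addn1 r.+1) expnD; apply: leq_trans (@Ndiag_supermul 3 r.+1 1 isT).
by apply: leq_mul; [exact: IHr | exact: Ndiag3_1].
Qed.

(** * Consequences of the Diagonal Conjecture *)

Section DC.

Hypothesis DC : DiagonalConjecture.

(** Each use of DC moves one unit from a colour [s] to the same colour [t]; as [t] only grows, the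
    condition [s <= t] persists. *)
Lemma DC_transfer j s t ks : 3 <= s -> s <= t -> all (leq 2) ks ->
  Ramsey (nseq j s.-1 ++ t + j :: ks) <= Ramsey (nseq j s ++ t :: ks).
Proof.
move=> s_ge3; elim: j t ks => [|j IHj] t ks lest ks_ge2; first by rewrite addn0.
have s_ge2 : 2 <= s.-1 by lia.
have s_ge2' : 2 <= s by lia.
have t_ge2 : 2 <= t by lia.
have st : s <= t.+1 by lia.
have /= IH := IHj t.+1 (s.-1 :: ks) st.
apply: leq_trans (leq_trans (IH _) _); rewrite ?s_ge2 //.
- apply: leq_perm_Ramsey; last by rewrite all_cat all_geq2_nseq //= s_ge2 ks_ge2 andbT; lia.
  rewrite addSnnS; apply/permP => p; rewrite /= !count_cat /= !count_nseq.
  lia.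
(* The colours are reordered so that the pair exchanged by DC stands in front. *)
apply: (@leq_trans (Ramsey (s.-1 :: t.+1 :: nseq j s ++ ks))).
  apply: leq_perm_Ramsey; last by rewrite /= all_cat all_geq2_nseq //= s_ge2 ks_ge2 andbT; lia.
  by apply/permP => p; rewrite /= !count_cat /= !count_nseq; lia.
apply: (@leq_trans (Ramsey (s :: t :: nseq j s ++ ks))).
  by apply: DC => //; rewrite all_cat all_geq2_nseq.
apply: leq_perm_Ramsey; last by rewrite /= all_cat all_geq2_nseq //= s_ge2' t_ge2.
by apply/permP => p; rewrite /= !count_cat /= !count_nseq; lia.
Qed.

(** The colours are split into [m] groups of [j.+1]; in each, one colour receives a unit from each
    of the [j] others. *)
Lemma DC_concentrate m j s ks : 3 <= s -> all (leq 2) ks ->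
  Ramsey (nseq (m * j) s.-1 ++ nseq m (s + j) ++ ks) <= Ramsey (nseq (m * j.+1) s ++ ks).
Proof.
move=> s_ge3; elim: m ks => [//|m IHm] ks ks_ge2.
have s_ge2 : 2 <= s.-1 by lia.
have s_ge2' : 2 <= s by lia.
have sj : 2 <= s + j by lia.
have ks'_ge2 : all (leq 2) (nseq j s.-1 ++ s + j :: ks).
  by rewrite all_cat all_geq2_nseq //= sj.
apply: leq_trans (leq_trans (IHm _ ks'_ge2) _).
  apply: leq_perm_Ramsey; last by rewrite !all_cat !all_geq2_nseq //= sj.
  by apply/permP => p; rewrite /= !(count_cat, count_nseq) /= !(count_cat, count_nseq) /=; lia.
apply: (@leq_trans (Ramsey (nseq j s.-1 ++ s + j :: (nseq (m * j.+1) s ++ ks)))).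
  apply: leq_perm_Ramsey; last by rewrite !all_cat /= !all_cat !all_geq2_nseq //= sj.
  by apply/permP => p; rewrite /= !(count_cat, count_nseq) /= !(count_cat, count_nseq) /=; lia.
apply: leq_trans (DC_transfer j s_ge3 (leqnn s) _) _.
  by rewrite all_cat all_geq2_nseq.
apply: leq_perm_Ramsey; last by rewrite !all_cat !all_geq2_nseq.
by apply/permP => p; rewrite /= !(count_cat, count_nseq) /= !(count_cat, count_nseq) /=; lia.
Qed.

(** In each group of k-2 colours of size 3, one grows to 3 + (k-3) = k while the others drop to 2
    and can be discarded. *)
Lemma Ndiag_leq_Ndiag3 k r : 3 <= k -> 0 < r -> Ndiag k r <= Ndiag 3 (r * (k - 2)).
Proof.
move=> k_ge3 r_gt0; apply: leq_predn.
have := @DC_concentrate r (k - 3) 3 [::] isT isT; rewrite !cats0.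
rewrite (_ : 3 + (k - 3) = k) 1?(_ : (k - 3).+1 = k - 2); [|lia..].
apply: leq_trans; rewrite -[nseq r k]cats0 catA /= cats0.
by apply: leq_Ramsey_pad; rewrite all_geq2_nseq //; lia.
Qed.

Lemma Ndiag_step k r : 3 <= k ->
  Ndiag k.-1 r * Ndiag 3 (r %/ (k - 2)) <= Ndiag k r.
Proof.
move=> k_ge3; set m := r %/ (k - 2); set q := r %% (k - 2).
have def_r : r = m * (k - 3).+1 + q.
  by rewrite (_ : (k - 3).+1 = k - 2) -?divn_eq //; lia.
have k_ge2 : 2 <= k by lia.
have conc := DC_concentrate m (k - 3) k_ge3 (all_geq2_nseq q k_ge2).
apply: (@leq_trans (Ramsey (nseq (m * (k - 3)) k.-1 ++
                            nseq m (k + (k - 3)) ++ nseq q k)).-1); last first.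
  by apply: leq_predn; rewrite /Ramsey_diag def_r nseqD.
have pad : Ramsey (nseq m 3) <= Ramsey (nseq (m * (k - 3)) 2 ++ nseq m 3 ++ nseq q 2).
  apply: leq_trans (leq_Ramsey_pad q (all_geq2_nseq m (_ : 2 <= 3))) _ => //.
  have q2m3 : all (leq 2) (nseq q 2 ++ nseq m 3) by rewrite all_cat !all_geq2_nseq.
  apply: leq_trans (leq_Ramsey_pad (m * (k - 3)) q2m3) _.
  apply: leq_perm_Ramsey; last by rewrite !all_cat !all_geq2_nseq.
  by rewrite perm_cat2l perm_catC.
apply: (@leq_trans ((Ramsey (nseq r k.-1)).-1 *
   (Ramsey (nseq (m * (k - 3)) 2 ++ nseq m 3 ++ nseq q 2)).-1)).
  by apply: leq_mul => //; apply: leq_predn.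
(* Position by position: (k-2)*1+1 = k-1, then (k-2)*2+1 = 2k-3, and on the [q] leftover colours
   (k-2)*1+1 <= k. *)
apply: Ramsey_prod; rewrite ?size_cat ?size_nseq //; try lia; move=> i i_lt.
rewrite !nth_cat !nth_nseq !size_nseq.
rewrite (_ : i < r); last by lia.
case: (ltnP i (m * (k - 3))) => lt1; first by rewrite /=; lia.
by case: (ltnP (i - m * (k - 3)) m) => lt2;
  [|have -> : i - m * (k - 3) - m < q by lia]; rewrite /=; lia.
Qed.

End DC.

(** * Growth rates *)

Local Open Scope R_scope.

(** * Superadditive sequences and Fekete's lemma *)

Lemma INR_leq m n : (m <= n)%N -> INR m <= INR n.
Proof. by move/leP/le_INR. Qed.

Lemma INR_gt0 n : (0 < n)%N -> 0 < INR n.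
Proof. by move/ltP/lt_0_INR. Qed.

(** With r = m p + q, superadditivity gives u r >= m u p, and m >= r/p - 1; the lost block costs the
    error term [u p / INR r]. *)
Lemma superadditive_lower (u : nat -> R) p r :
  (forall a b, u a + u b <= u (a + b)%N) -> (forall a, 0 <= u a) ->
  (0 < p)%N -> (0 < r)%N -> u p / INR p - u p / INR r <= u r / INR r.
Proof.
move=> u_add u_ge0 p_gt0 r_gt0; set m := (r %/ p)%N; set q := (r %% p)%N.
have lem : INR m * u p <= u r.
  have mulu n : INR n * u p <= u (n * p)%N.
    elim: n => [|n IHn]; first by rewrite Rmult_0_l.
    by rewrite S_INR mulSnr; have := u_add (n * p)%N p; lra.
  have := u_add (m * p)%N q; rewrite -divn_eq; have := mulu m; have := u_ge0 q; lra.
have ltr : INR r <= (INR m + 1) * INR p.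
  by rewrite -S_INR -mult_INR; apply: INR_leq; apply: ltnW (ltn_ceil r p_gt0).
have := INR_gt0 p_gt0; have := INR_gt0 r_gt0; have up := u_ge0 p => r0 p0.
apply: (Rmult_le_reg_r (INR r)) => //.
have -> : (u p / INR p - u p / INR r) * INR r = u p / INR p * INR r - u p by field; lra.
have -> : u r / INR r * INR r = u r by field; lra.
have : u p / INR p * INR r <= u p / INR p * ((INR m + 1) * INR p).
  apply: Rmult_le_compat_l => //; apply: Rmult_le_pos => //.
  by apply/Rlt_le/Rinv_0_lt_compat.
have -> : u p / INR p * ((INR m + 1) * INR p) = INR m * u p + u p by field; lra.
lra.
Qed.

Lemma is_lim_seq_div_INR (c : R) : is_lim_seq (fun n => c / INR n) 0.
Proof.
have inv0 : is_lim_seq (fun n => / INR n) 0.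
  exact: (is_lim_seq_inv _ _ is_lim_seq_INR).
by have := is_lim_seq_scal_l _ c _ inv0; rewrite /= Rmult_0_r.
Qed.

Lemma eventually_geq (P : nat -> Prop) n : (forall r, (n <= r)%N -> P r) -> eventually P.
Proof. by move=> nP; exists n => r /leP; apply: nP. Qed.

(** The limit is the supremum of the quotients at positive indices: by [superadditive_lower], any
    [M] below one quotient is eventually below all of them. *)
Lemma fekete (u : nat -> R) :
  (forall a b, u a + u b <= u (a + b)%N) -> (forall a, 0 <= u a) ->
  exists2 l : Rbar, is_lim_seq (fun r => u r / INR r) l & l <> m_infty.
Proof.
move=> u_add u_ge0.
have lower (p : nat) (M : R) : M < u p.+1 / INR p.+1 -> eventually (fun r => M < u r / INR r).
  set L := _ / _ => ltM; have /is_lim_seq_spec lim0 := is_lim_seq_div_INR (u p.+1).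
  have e_gt0 : 0 < L - M by lra.
  have [n nP] := lim0 (mkposreal _ e_gt0).
  exists n.+1 => r /leP ltnr; have /leP/nP := ltnW ltnr.
  rewrite Rminus_0_r => /Rabs_def2 [/= lt_ _].
  have := superadditive_lower (r := r) u_add u_ge0 (ltn0Sn p) (leq_ltn_trans (leq0n n) ltnr).
  rewrite -/L; lra.
have := Sup_seq_correct (fun n => Rbar.Finite (u n.+1 / INR n.+1)).
case: (Sup_seq _) => [l||] supl.
- exists (Rbar.Finite l) => //; apply/is_lim_seq_spec => e.
  have [ub [p /= ltp]] := supl e.
  have [n nP] := lower p _ ltp.
  exists n.+1 => -[|r] /leP ltnr; first by [].
  have /leP/nP := ltnW ltnr; have /= := ub r => lt1 lt2.
  by apply: Rabs_def1; lra.
- exists p_infty => //; apply/is_lim_seq_spec => M.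
  by have [p /= ltp] := supl M; apply: lower ltp.
- have /= := supl (u 1%N / INR 1 - 1) 0%N; lra.
Qed.

(** * Logarithmic growth of [Ndiag] and of the Ramsey numbers *)

Definition lnN k r := ln (INR (Ndiag k r)).

Lemma ln_0 : ln 0 = 0.
Proof. by rewrite /ln; case: Rlt_dec => // lt00; case: (Rlt_irrefl 0). Qed.

Lemma ln_INR_ge0 n : 0 <= ln (INR n).
Proof.
case: n => [|n]; first by rewrite ln_0; right.
by rewrite -ln_1; apply: ln_le; [lra | apply: (@INR_leq 1 n.+1)].
Qed.

Lemma ln_INR_leq m n : (0 < m)%N -> (m <= n)%N -> ln (INR m) <= ln (INR n).
Proof. by move=> m_gt0 lemn; apply: ln_le; [apply: INR_gt0 | apply: INR_leq]. Qed.

Lemma ln_INR_mul m n : (0 < m)%N -> (0 < n)%N ->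
  ln (INR (m * n)) = ln (INR m) + ln (INR n).
Proof. by move=> m_gt0 n_gt0; rewrite mult_INR ln_mult //; apply: INR_gt0. Qed.

Lemma lnN_superadd k a b : (2 <= k)%N -> lnN k a + lnN k b <= lnN k (a + b)%N.
Proof.
(* Without colours not even one vertex can be coloured, so [Ndiag k 0] is 0; the default [ln 0 = 0]
   then keeps superadditivity at index 0. *)
move=> k_ge2; have N0 : lnN k 0 = 0.
  have R0 : (Ramsey [::] <= 1)%N.
    by rewrite leqNgt; apply/negP => /lt_Ramsey[c [_ /(_ ord0 ord0)]].
  by rewrite /lnN /Ndiag /Ramsey_diag /=; case: (Ramsey _) R0 => [|[]] // _; apply: ln_0.
case: a => [|a]; first by rewrite N0 Rplus_0_l add0n; right.
case: b => [|b]; first by rewrite N0 Rplus_0_r addn0; right.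
have Na := Ndiag_gt0 k_ge2 (ltn0Sn a); have Nb := Ndiag_gt0 k_ge2 (ltn0Sn b).
rewrite -ln_INR_mul //; apply: ln_INR_leq; first by rewrite muln_gt0 Na.
exact: Ndiag_supermul.
Qed.

Lemma lnN_lim k : (2 <= k)%N ->
  exists2 l : Rbar, is_lim_seq (fun r => lnN k r / INR r) l & l <> m_infty.
Proof.
move=> k_ge2; apply: fekete => [a b|a]; first exact: lnN_superadd.
exact: ln_INR_ge0.
Qed.

(** Since N >= 1, R = N + 1 <= 2N; the resulting [ln 2] vanishes after division by [r]. *)
Lemma ln_Ramsey_bounds k r : (2 <= k)%N -> (0 < r)%N ->
  lnN k r <= ln (INR (Ramsey_diag r k)) <= lnN k r + ln 2.
Proof.
move=> k_ge2 r_gt0; have N_gt0 := Ndiag_gt0 k_ge2 r_gt0.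
have /andP[leN leR] : (Ndiag k r <= Ramsey_diag r k <= 2 * Ndiag k r)%N.
  by move: N_gt0; rewrite /Ndiag; lia.
split; first exact: ln_INR_leq.
by rewrite Rplus_comm -[2]/(INR 2) -ln_INR_mul //; apply: ln_INR_leq; rewrite ?(leq_trans N_gt0).
Qed.

Lemma ln_Ramsey_lim k (l : Rbar) : (2 <= k)%N -> is_lim_seq (fun r => lnN k r / INR r) l ->
  is_lim_seq (fun r => ln (INR (Ramsey_diag r k)) / INR r) l.
Proof.
move=> k_ge2 liml.
pose e r := ln (INR (Ramsey_diag r k)) / INR r - lnN k r / INR r.
have lime : is_lim_seq e 0.
  apply: (is_lim_seq_le_le_loc (fun _ => 0) _ (fun r => ln 2 / INR r)).
  - apply: (@eventually_geq _ 1) => r r_gt0; have := ln_Ramsey_bounds k_ge2 r_gt0.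
    have := Rinv_0_lt_compat _ (INR_gt0 r_gt0); rewrite /e /Rdiv; nra.
  - exact: is_lim_seq_const.
  - exact: is_lim_seq_div_INR.
apply: (is_lim_seq_ext (fun r => lnN k r / INR r + e r)) => [r|]; first by rewrite /e; lra.
apply: is_lim_seq_plus liml lime _.
by case: l => [l||]; rewrite /is_Rbar_plus /= ?Rplus_0_r.
Qed.

Lemma ramsey_ratioE k r :
  ramsey_ratio k r = exp (ln (INR (Ramsey_diag r k)) / INR r -
                          ln (INR (Ramsey_diag r k.-1)) / INR r).
Proof. by rewrite /ramsey_ratio /Rpower /Rdiv -exp_Ropp -exp_plus; congr exp; ring. Qed.

Lemma filterlim_divn d : (0 < d)%N -> filterlim (fun r => r %/ d)%N eventually eventually.
Proof.
move=> d_gt0 P [n nP]; apply: (@eventually_geq _ (n * d)) => r ler; apply: nP.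
by apply/leP; rewrite leq_divRL.
Qed.

(** * The limit of the ratio *)

Section Ratio.

Hypothesis DC : DiagonalConjecture.
Variable k : nat.
Hypothesis k_ge3 : (3 <= k)%N.

Let k_ge2 : (2 <= k)%N. Proof. by lia. Qed.
Let k1_ge2 : (2 <= k.-1)%N. Proof. by lia. Qed.
Let d_gt0 : (0 < k - 2)%N. Proof. by lia. Qed.

Let log_ratio r := ln (INR (Ramsey_diag r k)) / INR r - ln (INR (Ramsey_diag r k.-1)) / INR r.
(** The first term replaces [lnN 3 m / INR r], m = floor(r/(k-2)), by a multiple of a quotient with
    known limit; [ln 2 / INR r] pays for passing from N to R at [k.-1]. *)
Let log_ratio_low r :=
  / (2 * INR (k - 2)) * (lnN 3 (r %/ (k - 2)) / INR (r %/ (k - 2))) - ln 2 / INR r.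

Let log_ratio_ge : eventually (fun r => log_ratio_low r <= log_ratio r).
Proof.
apply: (@eventually_geq _ (k - 2)) => r ler.
have r_gt0 : (0 < r)%N by lia.
set m := (r %/ (k - 2))%N.
have m_gt0 : (0 < m)%N by rewrite divn_gt0.
have step : lnN k.-1 r + lnN 3 m <= lnN k r.
  have N1 := Ndiag_gt0 k1_ge2 r_gt0; have N3 := @Ndiag_gt0 3 _ isT m_gt0.
  rewrite -ln_INR_mul //; apply: ln_INR_leq; first by rewrite muln_gt0 N1.
  exact: Ndiag_step.
(* r <= (m+1)(k-2) <= 2m(k-2), because m >= 1. *)
have ler2 : INR r <= 2 * INR (k - 2) * INR m.
  rewrite -[2]/(INR 2) -!mult_INR; apply: INR_leq.
  have := ltn_ceil r d_gt0; rewrite -/m -[Nat.mul]/muln; nia.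
have [lek _] := ln_Ramsey_bounds k_ge2 r_gt0.
have [_ lek1] := ln_Ramsey_bounds k1_ge2 r_gt0.
have r0 := INR_gt0 r_gt0; have m0 := INR_gt0 m_gt0; have d0 := INR_gt0 d_gt0.
have l3 : 0 <= lnN 3 m := ln_INR_ge0 _.
have : / (2 * INR (k - 2)) * (lnN 3 m / INR m) <= lnN 3 m / INR r.
  have -> : / (2 * INR (k - 2)) * (lnN 3 m / INR m) = lnN 3 m / (2 * INR (k - 2) * INR m).
    by field; lra.
  apply: Rmult_le_compat_l => //; exact: Rinv_le_contravar.
rewrite /log_ratio_low /log_ratio -/m; have := Rinv_0_lt_compat _ r0; rewrite /Rdiv => ir.
have := Rmult_le_compat_r _ _ _ (Rlt_le _ _ ir) lek.
have := Rmult_le_compat_r _ _ _ (Rlt_le _ _ ir) lek1.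
have := Rmult_le_compat_r _ _ _ (Rlt_le _ _ ir) step.
lra.
Qed.

Let lnN3_ge m : (0 < m)%N -> ln 2 <= lnN 3 m / INR m.
Proof.
move=> m_gt0; have m0 := INR_gt0 m_gt0.
have : INR m * ln 2 <= lnN 3 m.
  rewrite -ln_pow; last by lra.
  apply: ln_le; first by apply: pow_lt; lra.
  rewrite -[2]/(INR 2) -pow_INR; apply: INR_leq.
  apply: leq_trans (Ndiag3_geq m_gt0).
  by elim: m {m_gt0 m0} => [//|m IHm] /=; rewrite expnS; lia.
move=> le; apply: (Rmult_le_reg_r (INR m)) => //.
by rewrite /Rdiv Rmult_assoc Rinv_l; lra.
Qed.

(** Floor division by k-2 tends to infinity, so the limit is inherited; [Rbar_mult] covers finite
    and infinite [l] at once. *)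
Let lim_low (l : Rbar) : is_lim_seq (fun r => lnN 3 r / INR r) l ->
  is_lim_seq log_ratio_low (Rbar_mult (/ (2 * INR (k - 2))) l).
Proof.
move=> liml.
have liml' := filterlim_comp _ _ _ _ _ _ _ _ (filterlim_divn d_gt0) liml.
have /= := is_lim_seq_scal_l _ (/ (2 * INR (k - 2))) _ liml' => lim1.
apply: (is_lim_seq_minus _ _ _ _ _ lim1 (is_lim_seq_div_INR (ln 2))).
case: (Rbar_mult _ _) => [x||]; rewrite /is_Rbar_minus /is_Rbar_plus /= ?Ropp_0 ?Rplus_0_r //.
Qed.

(** As exp x >= 1 + x, the ratio exceeds its logarithm, which is eventually above the divergent
    [log_ratio_low]. *)
Let lim_infinite : is_lim_seq (fun r => lnN 3 r / INR r) p_infty ->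
  is_lim_seq (ramsey_ratio k) p_infty.
Proof.
move=> /lim_low lim; have d0 := INR_gt0 d_gt0.
apply: is_lim_seq_le_p_loc (_ : is_lim_seq log_ratio_low p_infty).
  apply: filter_imp log_ratio_ge => r le; rewrite ramsey_ratioE -/(log_ratio r).
  by have := exp_ineq1_le (log_ratio r); lra.
move: lim; rewrite /=; congr is_lim_seq.
have ic : 0 < / (2 * INR (k - 2)) by apply: Rinv_0_lt_compat; lra.
rewrite /Rbar_mult /=; case: Rle_dec => [H|]; last by lra.
by case: Rle_lt_or_eq_dec => //; lra.
Qed.

(** The quotient is at most k-2 times the one for 3 at index r(k-2), which tends to (k-2) l.
    Comparing through [k] also covers j = 2, which occurs as k-1 when k = 3. *)
Let lnN_lim_finite (l : R) j : (2 <= j)%N -> (j <= k)%N ->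
  is_lim_seq (fun r => lnN 3 r / INR r) l ->
  exists l' : R, is_lim_seq (fun r => lnN j r / INR r) l'.
Proof.
move=> j_ge2 lejk liml; have [l' liml' l'_neq] := lnN_lim j_ge2.
have d0 := INR_gt0 d_gt0.
have /(is_lim_seq_scal_l _ (INR (k - 2))) lim3 : is_lim_seq
    (fun r => lnN 3 (r * (k - 2))%N / INR (r * (k - 2))%N) l.
  apply: filterlim_comp liml => P [n nP]; exists n => r /leP ler; apply: nP.
  by apply/leP; nia.
have : Rbar_le l' (INR (k - 2) * l).
  apply: is_lim_seq_le_loc liml' lim3; apply: (@eventually_geq _ 1) => r r_gt0.
  have r0 := INR_gt0 r_gt0; rewrite mult_INR.
  have -> : INR (k - 2) * (lnN 3 (r * (k - 2))%N / (INR r * INR (k - 2))) =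
            lnN 3 (r * (k - 2))%N / INR r by field; lra.
  apply: Rmult_le_compat_r; first exact/Rlt_le/Rinv_0_lt_compat.
  apply: ln_INR_leq; first exact: Ndiag_gt0.
  exact: leq_trans (leq_Ndiag r lejk) (Ndiag_leq_Ndiag3 DC k_ge3 r_gt0).
by case: l' liml' l'_neq => [l'||] // liml' _ _; exists l'.
Qed.

(** The logarithm of the ratio tends to [x - y], which is at least l / (2(k-2)) >= ln 2 / (2(k-2)) >
    0; continuity of [exp] concludes. *)
Let lim_finite (l : R) : is_lim_seq (fun r => lnN 3 r / INR r) l ->
  exists2 L : R, is_lim_seq (ramsey_ratio k) L & 1 < L.
Proof.
move=> liml.
have [x /(ln_Ramsey_lim k_ge2) limx] := lnN_lim_finite k_ge2 (leqnn k) liml.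
have [y /(ln_Ramsey_lim k1_ge2) limy] := lnN_lim_finite k1_ge2 (leq_pred k) liml.
have limD : is_lim_seq log_ratio (x - y) by apply: is_lim_seq_minus' limx limy.
have l_ge : ln 2 <= l.
  apply: (is_lim_seq_le_loc (fun _ => ln 2) _ (ln 2) l _ _ liml).
    exact: (@eventually_geq _ 1).
  exact: is_lim_seq_const.
have := is_lim_seq_le_loc _ _ _ _ log_ratio_ge (lim_low liml) limD; rewrite /= => lexy.
have ln2 := ln_lt_2; have d0 := INR_gt0 d_gt0.
have ic : 0 < / (2 * INR (k - 2)) by apply: Rinv_0_lt_compat; lra.
exists (exp (x - y)).
  apply: (is_lim_seq_ext (fun r => exp (log_ratio r))) => [r|]; first by rewrite ramsey_ratioE.
  apply: is_lim_seq_continuous limD.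
  exact/derivable_continuous_pt/derivable_pt_exp.
by rewrite -exp_0; apply: exp_increasing; nra.
Qed.

Lemma ramsey_ratio_lim :
  exists L : Rbar, is_lim_seq (ramsey_ratio k) L /\ Rbar_lt 1 L.
Proof.
have [l] := @lnN_lim 3 isT; case: l => [l||] // liml _.
  by have [L limL L_gt1] := lim_finite liml; exists L.
by exists p_infty; split=> //; apply: lim_infinite.
Qed.

End Ratio.

Theorem theorem3 :
  DiagonalConjecture ->
  forall k : nat, (3 <= k)%N ->
    exists L : Rbar, is_lim_seq (ramsey_ratio k) L /\ Rbar_lt (Rbar.Finite R1) L.
Proof. exact: ramsey_ratio_lim. Qed.
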